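(* Let $D\ge 1$, $n\ge 1$. There exist two absolute positive constants $c,c'$ such that $$\inf_{\widehat p}\ \sup_{p\in\Delta_D}\ \mathbb{P}_p\Big(\|\widehat p-p\|_1\ \ge\ c\,\min\big\{\sqrt{D/n},\,1\big\}\Big)\ \ge\ c'$$ and $$\inf_{\widehat p}\ \sup_{p\in\Delta_D}\ \mathbb{E}_p\|\widehat p-p\|_1\ \ge\ c\,\min\big\{\sqrt{D/n},\,1\big\}.$$
   Context: $D$ and $n$ are integers. $\Delta_D=\{p\in\mathbb{R}_+^D:\ \sum_{j=1}^D p_j=1\}$ is the set of all probability distributions on $\{1,\dots,D\}$. $\mathbb{P}_p$ is the probability measure of $n$ iid observations $X_1,\dots,X_n$ drawn from $p$, and $\mathbb{E}_p$ is the expectation with respect to $\mathbb{P}_p$. $\inf_{\widehat p}$ is the infimum over all $\mathbb{R}^D$-valued estimators, i.e. measurable functions of $(X_1,\dots,X_n)$. $\|\cdot\|_1$ is the $\ell_1$ norm on $\mathbb{R}^D$.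
   Formalization: The formal statement assumes D ≥ 2 instead of D ≥ 1: for D = 1 the simplex is a single point, the constant estimator 1 has zero loss, and both printed lower bounds fail for every positive c, c'. *)

(* Defs.v *)
From mathcomp Require Import all_boot all_order all_algebra.
From mathcomp Require Import boolp classical_sets reals constructive_ereal ereal.

Set Implicit Arguments.
Unset Strict Implicit.
Unset Printing Implicit Defensive.

Import Order.TTheory GRing.Theory Num.Theory.
Local Open Scope classical_set_scope.
Local Open Scope ring_scope.

Definition simplex (R : realType) (D : nat) : set 'rV[R]_D :=
  [set p | (forall j, 0 <= p 0 j) /\ \sum_(j < D) p 0 j = 1].

Definition l1norm (R : realType) (D : nat) (v : 'rV[R]_D) : R :=
  \sum_(j < D) `|v 0 j|.

(* Realisations of (X_1, ..., X_n), with labels 0, ..., D-1. *)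
Definition sample (D n : nat) := {ffun 'I_n -> 'I_D}.

(* Mass at x of the product law of n independent draws from p. The sample space
   is finite with all subsets measurable, so probabilities and expectations are
   finite sums and every function of the sample is measurable. *)
Definition iid_mass (R : realType) (D n : nat) (p : 'rV[R]_D)
    (x : sample D n) : R :=
  \prod_(i < n) p 0 (x i).

Definition Pr (R : realType) (D n : nat) (p : 'rV[R]_D)
    (A : pred (sample D n)) : R :=
  \sum_(x | A x) iid_mass p x.

Definition Ex (R : realType) (D n : nat) (p : 'rV[R]_D)
    (f : sample D n -> R) : R :=
  \sum_x iid_mass p x * f x.

Definition estimator (R : realType) (D n : nat) := sample D n -> 'rV[R]_D.

(* The supremum over p and the infimum over estimators are taken in the extended
   reals, where they always exist. *)
Definition minimax (R : realType) (D n : nat)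
    (risk : estimator R D n -> 'rV[R]_D -> R) : \bar R :=
  ereal_inf [set ereal_sup [set (risk phat p)%:E | p in @simplex R D]
            | phat in [set: estimator R D n]].

Definition rate (R : realType) (D n : nat) : R :=
  Num.min (Num.sqrt (D%:R / n%:R)) 1.

(* Main.v *)
Require Import Defs.
From mathcomp Require Import all_boot all_order all_algebra.
From mathcomp Require Import boolp classical_sets reals constructive_ereal ereal.
From mathcomp Require Import ring lra zify.

(** Assouad's hypercube argument.  Up to one leftover symbol of mass zero, the
    alphabet is split into [m = D./2] pairs of total mass [1 / m] each, and each
    pair is tilted by a relative amount [g = rate / 4] in one of two directions.
    This gives [2 ^ m] distributions, the vertices of a cube.

    An estimator of the distribution decodes to a vertex by thresholding one
    coordinate of every pair, and each wrongly decoded pair costs at least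
    [g / (2 * m)] in l1 norm ([hamming_le_l1norm]).  On the other hand the tilt is
    too small to be detected.  Flipping the direction of one pair moves the law
    of one observation by a squared Hellinger distance of order [g ^ 2 / m] only,
    and [n * g ^ 2 / m] is at most [1 / 4]; so the two product laws share
    a mass of at least [1 / 4] ([affinity_vertex]), and no test separates them.
    Averaging over the cube ([assouad]), some vertex has an expected number of
    wrong pairs of at least [m / 8], that is, an expected loss of order [g].

    The bound in probability comes from the same vertex.  The number of wrong
    pairs never exceeds [m], so a mean of [m / 8] forces it above [m / 16] with
    probability at least [1 / 16] ([reverse_markov]).  Passing through this
    bounded loss is what makes the probability independent of [D]. *)

Set Implicit Arguments.
Unset Strict Implicit.
Unset Printing Implicit Defensive.

Import Order.TTheory GRing.Theory Num.Theory.
Local Open Scope classical_set_scope.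
Local Open Scope ring_scope.

Lemma bernoulli_inequality (R : realType) (t : R) k :
  t <= 1 -> 1 - k%:R * t <= (1 - t) ^+ k.
Proof.
move=> t1; elim: k => [|k IH]; first by rewrite mul0r subr0.
rewrite exprS; apply: le_trans (ler_wpM2l _ IH); last by rewrite subr_ge0.
have : 0 <= k%:R * t ^+ 2 by rewrite mulr_ge0 ?sqr_ge0.
by rewrite -natr1; lra.
Qed.

(** * Product laws on the sample space *)

Section Product.
Variables (R : realType) (D n : nat).
Implicit Types (p q r : 'rV[R]_D) (x : sample D n).

Lemma sum_iid_mass p : \sum_(x : sample D n) iid_mass p x = (\sum_(k < D) p 0 k) ^+ n.
Proof.
rewrite /iid_mass -(bigA_distr_bigA (fun (_ : 'I_n) k => p 0 k)).
by rewrite prodr_const card_ord.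
Qed.

Lemma iid_mass_ge0 p x : (forall k, 0 <= p 0 k) -> 0 <= iid_mass p x.
Proof. by move=> p0; apply: prodr_ge0. Qed.

Lemma sum_iid_mass_simplex p : p \in @simplex R D -> \sum_(x : sample D n) iid_mass p x = 1.
Proof. by move=> /set_mem[_ p1]; rewrite sum_iid_mass p1 expr1n. Qed.

(** The common mass of the two product laws, which is one minus their total
    variation distance. *)
Definition affinity p q : R :=
  \sum_(x : sample D n) Num.min (iid_mass p x) (iid_mass q x).

(** Le Cam's two-point bound: every sample counts towards one of the two errors,
    and there it weighs at least the smaller of the two masses. *)
Lemma affinity_le_errors p q (A : pred (sample D n)) :
  affinity p q <= Pr p A + Pr q (predC A).
Proof.
rewrite /affinity (bigID A) /=.
by apply: lerD; apply: ler_sum => x _; rewrite ge_min lexx ?orbT.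
Qed.

(** For [g] the geometric mean of [a] and [b], the inequality
    [g <= (t * min + max / t) / 2] at [t = 2] bounds the minimum from below by an
    expression linear in [g], [a] and [b].  Being linear, it can be summed over
    all samples without the Cauchy-Schwarz inequality that usually relates
    affinity and Hellinger distance. *)
Lemma geomean_le_min (a b g : R) : 0 <= a -> 0 <= b -> g ^+ 2 <= a * b ->
  g - (a + b) / 4 <= Num.min a b.
Proof.
move=> a0 b0 gab.
wlog ab : a b a0 b0 gab / a <= b.
  move=> W; have /orP[ab|ba] := le_total a b; first exact: W.
  by rewrite minC [a + b]addrC; apply: W; rewrite // mulrC.
rewrite min_l //.
have : g <= (5 * a + b) / 4; last lra.
rewrite leNgt; apply/negP => h.
(* Otherwise [g ^ 2] exceeds the square of the mean [(5 a + b) / 4], which is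
   at least [a b] as the difference is [((3 a - b) ^ 2 + 16 a ^ 2) / 16]. *)
have : 0 < (g - (5 * a + b) / 4) * (g + (5 * a + b) / 4).
  by apply: mulr_gt0; lra.
have := sqr_ge0 (3 * a - b); have := sqr_ge0 a; lra.
Qed.

(** Hellinger affinity tensorizes: the sum over samples of the products of [r] is
    the [n]-th power of a sum over symbols.  Any [r] below the pointwise geometric
    mean of [p] and [q] will do, so [r] can be chosen free of square roots. *)
Lemma affinity_ge p q r : p \in @simplex R D -> q \in @simplex R D ->
  (forall k, 0 <= r 0 k) -> (forall k, r 0 k ^+ 2 <= p 0 k * q 0 k) ->
  (\sum_(k < D) r 0 k) ^+ n - 1 / 2 <= affinity p q.
Proof.
move=> pS qS r0 rpq.
have [[p0 _] [q0 _]] := (set_mem pS, set_mem qS).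
have -> : (\sum_(k < D) r 0 k) ^+ n - 1 / 2 =
  \sum_(x : sample D n) (iid_mass r x - (iid_mass p x + iid_mass q x) / 4).
  rewrite big_split /= sumrN -mulr_suml big_split /= -sum_iid_mass.
  by rewrite (sum_iid_mass_simplex pS) (sum_iid_mass_simplex qS); field.
apply: ler_sum => x _; apply: geomean_le_min; rewrite ?iid_mass_ge0 //.
rewrite /iid_mass -prodrXl -big_split /=.
by apply: ler_prod => i _; rewrite sqr_ge0 rpq.
Qed.

(** A variable bounded by [M] cannot keep a large mean while being mostly below
    [t]; this turns a bound in expectation into one in probability. *)
Lemma reverse_markov p (f : sample D n -> R) (M t : R) : p \in @simplex R D ->
  (forall x, f x <= M) -> 0 <= t ->
  Ex p f <= t + M * Pr p (fun x => t <= f x).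
Proof.
move=> pS fM t0; have [p0 _] := set_mem pS.
rewrite -[t in t + _]mulr1 -(sum_iid_mass_simplex pS) /Pr !mulr_sumr.
rewrite [X in _ + X]big_mkcond -big_split; apply: ler_sum => x _ /=.
have m0 := iid_mass_ge0 x p0; have fMx := fM x.
by case: (leP t (f x)) => h; nra.
Qed.

Lemma ler_Ex p (f g : sample D n -> R) : p \in @simplex R D ->
  (forall x, f x <= g x) -> Ex p f <= Ex p g.
Proof.
move=> /set_mem[p0 _] fg; apply: ler_sum => x _.
by rewrite ler_wpM2l ?iid_mass_ge0.
Qed.

Lemma subset_Pr p (A B : pred (sample D n)) : p \in @simplex R D ->
  (forall x, A x -> B x) -> Pr p A <= Pr p B.
Proof.
move=> /set_mem[p0 _] AB; rewrite /Pr big_mkcond [leRHS]big_mkcond /=.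
apply: ler_sum => x _; have m0 := iid_mass_ge0 x p0.
by case: (boolP (A x)) => [/AB ->//|_]; case: ifP.
Qed.

Lemma ExZ p (c : R) (f : sample D n -> R) :
  Ex p (fun x => c * f x) = c * Ex p f.
Proof. by rewrite /Ex mulr_sumr; apply: eq_bigr => x _; rewrite mulrCA. Qed.

End Product.

(** * Assouad's lemma *)

Section Cube.
Variable m : nat.
Local Notation cube := {ffun 'I_m -> bool}.
Implicit Types (u w : cube) (j : 'I_m).

Definition flip j w : cube := [ffun i => (i == j) (+) w i].

Lemma flipK j : involutive (flip j).
Proof. by move=> w; apply/ffunP => i; rewrite !ffunE addKb. Qed.

Definition hamming u w : nat := \sum_(j < m) (u j != w j).

Lemma hamming_le u w : (hamming u w <= m)%N.
Proof.
rewrite -[leqRHS]card_ord -sum1_card; apply: leq_sum => j _; exact: leq_b1.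
Qed.

(** For each coordinate, pairing every vertex with its neighbour makes the decoding
    of that coordinate a two-point testing problem, with total error at least [a].
    Summing over coordinates and vertices gives the bound on average over the
    cube, hence at some vertex.  The witness is a single vertex so that it can
    serve for both the expectation and the probability. *)
Lemma assouad (R : realType) (D n : nat) (P : cube -> 'rV[R]_D) (a : R)
    (psi : sample D n -> cube) :
  (forall w j, a <= affinity n (P w) (P (flip j w))) ->
  exists w, m%:R * (a / 2) <= Ex (P w) (fun x => (hamming (psi x) w)%:R).
Proof.
move=> Pa.
have ExE w : Ex (P w) (fun x => (hamming (psi x) w)%:R) =
    \sum_(j < m) Pr (P w) (fun x => psi x j != w j).
  rewrite /Ex /Pr.
  under [RHS]eq_bigr do rewrite big_mkcond.
  rewrite exchange_big /=; apply: eq_bigr => x _.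
  rewrite natr_sum mulr_sumr; apply: eq_bigr => j _.
  by case: (psi x j != w j); rewrite ?mulr1 ?mulr0.
have err j : #|cube|%:R * a <= (\sum_w Pr (P w) (fun x => psi x j != w j)) *+ 2.
  (* Doubling the sum makes every edge of direction [j] contribute both ends. *)
  rewrite mulr2n [X in _ + X](reindex_inj (inv_inj (flipK j))) /=.
  rewrite -big_split /= mulrC mulr_natr -sumr_const.
  apply: ler_sum => w _; apply: le_trans (Pa w j) _.
  apply: le_trans (affinity_le_errors _ _ (fun x => psi x j != w j)) _.
  rewrite lerD2l.
  rewrite le_eqVlt; apply/orP; left; apply/eqP; apply: eq_bigl => x /=.
  by rewrite ffunE eqxx /=; case: (psi x j); case: (w j).
apply: contrapT => /forallNP H.
have lt w : Ex (P w) (fun x => (hamming (psi x) w)%:R) < m%:R * (a / 2).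
  by rewrite ltNge; apply/negP/H.
have : \sum_w Ex (P w) (fun x => (hamming (psi x) w)%:R) <
       \sum_(w : cube) m%:R * (a / 2).
  by apply: ltr_sum => //; apply/hasP; exists [ffun=> false].
rewrite sumr_const; apply/negP; rewrite -leNgt.
under eq_bigr do rewrite ExE.
have -> : m%:R * (a / 2) *+ #|cube| = \sum_(j < m) #|cube|%:R * a / 2.
  by rewrite sumr_const card_ord -mulr_natl -[RHS]mulr_natl; ring.
rewrite exchange_big /=; apply: ler_sum => j _; have := err j.
rewrite mulr2n; lra.
Qed.

End Cube.

(** * The hypercube of tilted distributions *)

Section Hypercube.
Variables (R : realType) (m s : nat) (g : R).
Hypotheses (m0 : (0 < m)%N) (g0 : 0 <= g) (g1 : g <= 1).
Local Notation cube := {ffun 'I_m -> bool}.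
Local Notation D := (m + m + s)%N.
Implicit Types w : cube.

(** The pair of index [j] consists of the [j]-th symbols of the first two blocks
    of length [m]; the last block holds the leftover symbols. *)
Definition pairs_row (F G : 'I_m -> R) : 'rV[R]_D :=
  row_mx (row_mx (\row_j F j) (\row_j G j)) 0.

Lemma sum_pairs_row (F G : 'I_m -> R) :
  \sum_(k < D) pairs_row F G 0 k = \sum_(j < m) (F j + G j).
Proof.
rewrite !big_split_ord /= [X in _ + X]big1 ?addr0; last first.
  by move=> k _; rewrite row_mxEr mxE.
rewrite big_split /=; congr +%R; apply: eq_bigr => j _.
  by rewrite row_mxEl row_mxEl mxE.
by rewrite row_mxEl row_mxEr mxE.
Qed.

Lemma pairs_row_ind (P : 'I_D -> Prop) :
  (forall j, P (lshift s (lshift m j))) -> (forall j, P (lshift s (rshift m j))) ->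
  (forall k, P (rshift (m + m) k)) -> forall k, P k.
Proof.
move=> Pl Pr P0 k; rewrite -(splitK k); case: (split k) => [i|//] /=.
by rewrite -(splitK i); case: (split i).
Qed.

Lemma pairs_rowE (F G : 'I_m -> R) :
  (forall j, pairs_row F G 0 (lshift s (lshift m j)) = F j) *
  (forall j, pairs_row F G 0 (lshift s (rshift m j)) = G j) *
  (forall k, pairs_row F G 0 (rshift (m + m) k) = 0).
Proof.
by split; [split|] => j; rewrite ?row_mxEl ?row_mxEr ?row_mxEl ?mxE.
Qed.

Definition tilt (b : bool) : R := (if b then 1 + g else 1 - g) / (2 * m%:R).

Definition vertex w : 'rV[R]_D :=
  pairs_row (fun j => tilt (w j)) (fun j => tilt (~~ w j)).

Let M0 : 0 < m%:R :> R. Proof. by rewrite ltr0n. Qed.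

Lemma tilt_ge0 b : 0 <= tilt b.
Proof.
apply: divr_ge0; last by rewrite mulr_ge0 // ler0n.
by case: b; rewrite ?subr_ge0 ?addr_ge0.
Qed.

Lemma tiltD b : tilt b + tilt (~~ b) = m%:R^-1.
Proof.
rewrite /tilt; case: b => /=; field; exact: lt0r_neq0.
Qed.

Lemma tiltM b : tilt b * tilt (~~ b) = (1 - g ^+ 2) / (2 * m%:R) ^+ 2.
Proof.
rewrite /tilt; case: b => /=; field; exact: lt0r_neq0.
Qed.

Lemma vertex_simplex w : vertex w \in @simplex R D.
Proof.
apply/mem_set; split.
  apply: pairs_row_ind => j; rewrite pairs_rowE ?tilt_ge0 //.
rewrite sum_pairs_row; under eq_bigr do rewrite tiltD.
by rewrite sumr_const card_ord -[RHS](mulVf (lt0r_neq0 M0)) mulr_natr.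
Qed.

(** Neighbouring vertices differ on one pair only, where the product of their masses
    is [(1 - g ^ 2) / (2 m) ^ 2].  Since [(1 - g ^ 2) ^ 2 <= 1 - g ^ 2], replacing
    the square root of the latter by [1 - g ^ 2] gives an admissible [r] of total
    mass [1 - g ^ 2 / m], and its [n]-th power is at least [3 / 4]. *)
Lemma affinity_vertex n w j : n%:R * g ^+ 2 <= m%:R / 4 ->
  1 / 4 <= affinity n (vertex w) (vertex (flip j w)).
Proof.
move=> ng.
pose r := pairs_row
  (fun i => if i == j then (1 - g ^+ 2) / (2 * m%:R) else tilt (w i))
  (fun i => if i == j then (1 - g ^+ 2) / (2 * m%:R) else tilt (~~ w i)).
have q0 : 0 <= 1 - g ^+ 2 by rewrite subr_ge0 expr_le1.
have d0 : 0 <= (1 - g ^+ 2) / (2 * m%:R).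
  by rewrite divr_ge0 // mulr_ge0 // ler0n.
have d2 b : ((1 - g ^+ 2) / (2 * m%:R)) ^+ 2 <= tilt b * tilt (~~ b).
  rewrite tiltM expr_div_n ler_wpM2r ?invr_ge0 ?sqr_ge0 //.
  by rewrite expr2 ler_piMl // lerBlDr lerDl sqr_ge0.
have sr : \sum_(k < D) r 0 k = 1 - g ^+ 2 / m%:R.
  rewrite sum_pairs_row.
  transitivity (\sum_(i < m) (m%:R^-1 - (if i == j then g ^+ 2 / m%:R else 0))).
    apply: eq_bigr => i _; case: eqP => _; last by rewrite tiltD subr0.
    by field; exact: lt0r_neq0.
  rewrite sumrB sumr_const card_ord -big_mkcond /= big_pred1_eq.
  by rewrite -[_ *+ m]mulr_natr mulVf ?lt0r_neq0.
have : (\sum_(k < D) r 0 k) ^+ n - 1 / 2 <= affinity n (vertex w) (vertex (flip j w)).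
  apply: affinity_ge; rewrite ?vertex_simplex //.
    by apply: pairs_row_ind => i; rewrite pairs_rowE //; case: ifP; rewrite ?tilt_ge0.
  apply: pairs_row_ind => i; rewrite !pairs_rowE ?ffunE.
  - case: eqP => [->|_] /=; last by rewrite expr2.
    exact: d2.
  - case: eqP => [->|_] /=; last by rewrite expr2.
    exact: d2.
  - by rewrite expr2.
apply: le_trans; rewrite sr.
have t1 : g ^+ 2 / m%:R <= 1.
  rewrite ler_pdivrMr // mul1r; apply: (@le_trans _ _ 1); rewrite ?ler1n //.
  by rewrite expr_le1.
have : n%:R * (g ^+ 2 / m%:R) <= 1 / 4.
  rewrite mulrA ler_pdivrMr //; lra.
have := bernoulli_inequality n t1; lra.
Qed.

(** The threshold [1 / (2 m)] is the untilted mass, halfway between the two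
    possible values of the coordinate. *)
Definition decode (v : 'rV[R]_D) : cube :=
  [ffun j => (2 * m%:R)^-1 <= v 0 (lshift s (lshift m j))].

Lemma hamming_le_l1norm (v : 'rV[R]_D) w :
  g / (2 * m%:R) * (hamming (decode v) w)%:R <= l1norm (v - vertex w).
Proof.
rewrite /l1norm !big_split_ord /= -addrA.
apply: ler_wpDr; first by apply: addr_ge0; apply: sumr_ge0.
rewrite natr_sum mulr_sumr; apply: ler_sum => j _.
rewrite mxE [X in _ + X]mxE pairs_rowE ffunE /tilt.
have : 0 <= g / (2 * m%:R) by rewrite divr_ge0 // mulr_ge0 // ler0n.
have -> : (if w j then 1 + g else 1 - g) / (2 * m%:R) =
    (2 * m%:R)^-1 + (if w j then g / (2 * m%:R) else - (g / (2 * m%:R))).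
  by case: (w j); rewrite mulrDl mul1r ?mulNr.
set d := g / _; set e := _^-1; set y := v _ _ => dge0.
by case: (w j); case: (leP e y) => h /=; rewrite ?mulr0 ?normr_ge0 // mulr1;
   rewrite ler_normr; apply/orP; (left + right); lra.
Qed.

End Hypercube.

(** * The lower bounds *)

(** With [D <= 3 m] one has [rate ^ 2 <= 3 m / n], so a quarter of the rate is a
    tilt that [n] observations cannot detect. *)
Lemma rate_sqr_le (R : realType) (m s n : nat) : (0 < m)%N -> (s <= 1)%N ->
  (0 < n)%N -> n%:R * (rate R (m + m + s) n / 4) ^+ 2 <= m%:R / 4 :> R.
Proof.
move=> m0 s1 n0; have N0 : 0 < n%:R :> R by rewrite ltr0n.
have r0 : 0 <= rate R (m + m + s) n by rewrite le_min sqrtr_ge0 ler01.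
have : rate R (m + m + s) n ^+ 2 <= (m + m + s)%:R / n%:R.
  rewrite -[leRHS]sqr_sqrtr ?divr_ge0 ?ler0n //.
  by rewrite lerXn2r ?nnegrE ?sqrtr_ge0 // ge_min lexx.
rewrite ler_pdivlMr // => H.
have : (m + m + s)%:R <= 3 * m%:R :> R by rewrite -natrM ler_nat; lia.
have M0 : 0 <= m%:R :> R by [].
lra.
Qed.

(** A vertex with mean Hamming error [m / 8] has mean loss at least
    [g / (2 m) * (m / 8) = rate / 64], and loss at least
    [g / (2 m) * (m / 16) = rate / 128] with probability [1 / 16]; the smaller of
    the two constants serves for both bounds. *)
Lemma hard_distribution (R : realType) (D n : nat) (phat : estimator R D n) :
  (2 <= D)%N -> (1 <= n)%N ->
  exists p, [/\ p \in @simplex R D,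
    16^-1 <= Pr p (fun x => 128^-1 * rate R D n <= l1norm (phat x - p)) &
    128^-1 * rate R D n <= Ex p (fun x => l1norm (phat x - p))].
Proof.
move=> D2 n1.
have [m [s [DE m0 s1]]] : exists m s : nat,
    [/\ D = (m + m + s)%N, (0 < m)%N & (s <= 1)%N].
  by exists D./2, (odd D); split; [lia|lia|case: odd].
subst D; set r := rate R _ n; pose g := r / 4.
have r0 : 0 <= r by rewrite le_min sqrtr_ge0 ler01.
have r1 : r <= 1 by rewrite ge_min lexx orbT.
have g0 : 0 <= g by rewrite /g; lra.
have g1 : g <= 1 by rewrite /g; lra.
have M0 : 0 < m%:R :> R by rewrite ltr0n.
have [w Ew] := assouad (fun x => decode (phat x))
  (fun w j => affinity_vertex s m0 g0 g1 w j (rate_sqr_le R m0 s1 n1)).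
pose p := vertex s g w; have pS : p \in @simplex R _ by exact: vertex_simplex.
pose H x : R := (hamming (decode (phat x)) w)%:R.
have Hl x : g / (2 * m%:R) * H x <= l1norm (phat x - p).
  exact: hamming_le_l1norm.
exists p; split => //.
- apply: (@le_trans _ _ (Pr p (fun x => m%:R / 16 <= H x))).
    have Hm x : H x <= m%:R by rewrite ler_nat hamming_le.
    have t0 : 0 <= m%:R / 16 :> R by rewrite divr_ge0 // ler0n.
    rewrite -(ler_pM2l M0); have := reverse_markov pS Hm t0.
    move: Ew; rewrite -/p -/H; lra.
  apply: subset_Pr => // x Hx; apply: le_trans (Hl x).
  have -> : 128^-1 * r = g / (2 * m%:R) * (m%:R / 16).
    by rewrite /g; field; exact: lt0r_neq0.
  by rewrite ler_wpM2l // divr_ge0 // mulr_ge0 // ler0n.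
- apply: le_trans (ler_Ex pS Hl); rewrite ExZ.
  apply: (@le_trans _ _ (g / (2 * m%:R) * (m%:R * (1 / 4 / 2)))).
    have -> : g / (2 * m%:R) * (m%:R * (1 / 4 / 2)) = 64^-1 * r.
      by rewrite /g; field; exact: lt0r_neq0.
    lra.
  by rewrite ler_wpM2l // divr_ge0 // mulr_ge0 // ler0n.
Qed.

Lemma le_minimax (R : realType) (D n : nat)
    (risk : estimator R D n -> 'rV[R]_D -> R) (a : R) :
  (forall phat, exists2 p, p \in @simplex R D & a <= risk phat p) ->
  (a%:E <= minimax risk)%E.
Proof.
move=> H; apply: le_ereal_inf_tmp => _ [phat _ <-].
have [p pS ap] := H phat; apply: le_ereal_sup_tmp.
by exists (risk phat p)%:E; rewrite ?lee_fin //; exists p => //; exact: set_mem.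
Qed.

(* For D = 1 the simplex is a single point and the constant estimator has zero
   risk, so the bounds fail there and start at D = 2. *)
Theorem theorem1 (R : realType) :
  exists c c' : R, 0 < c /\ 0 < c' /\
    forall D n : nat, (2 <= D)%N -> (1 <= n)%N ->
      (c'%:E <= minimax (fun (phat : estimator R D n) (p : 'rV[R]_D) =>
          Pr p (fun x => c * rate R D n <= l1norm (phat x - p))%R))%E
      /\
      ((c * rate R D n)%R%:E <= minimax (fun (phat : estimator R D n) (p : 'rV[R]_D) =>
          Ex p (fun x => l1norm (phat x - p)%R)))%E.
Proof.
exists 128^-1, 16^-1; split; [by rewrite invr_gt0 | split; [by rewrite invr_gt0|]].
move=> D n D2 n1; split; apply: le_minimax => phat;
  by have [p [pS pPr pEx]] := hard_distribution phat D2 n1; exists p.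
Qed.
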